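(* Let $G$ be a locally finite $D(1)$-group. Then $G$ is a finite group.
   Context: Groups may be finite or infinite. A non-trivial element $x$ of a group $G$ (and its conjugacy class $x^G$) is called deficient if $\langle x\rangle$ is properly contained in $C_G(x)$, and non-deficient if $\langle x\rangle = C_G(x)$. A $D(1)$-group is a group with exactly one deficient non-trivial conjugacy class. A group is locally finite if each of its finitely generated subgroups is finite. *)

(* Defs.v *)
(* MathComp, with the classical sets of MathComp-Analysis. *)
From mathcomp Require Export all_boot.
From mathcomp Require Export boolp classical_sets functions cardinality.

Set Implicit Arguments.
Unset Strict Implicit.
Unset Printing Implicit Defensive.

Local Open Scope group_scope.
Local Open Scope classical_set_scope.

(* [groupType] is the structure of arbitrary, possibly infinite, groups.
   Its decidable equality and choice operator exist classically on any type,
   so they are no restriction on the group. *)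

Definition is_subgroup (G : groupType) (H : set G) : Prop :=
  H 1 /\ forall x y, H x -> H y -> H (x / y).

Definition generated (G : groupType) (A : set G) : set G :=
  smallest (@is_subgroup G) A.

Definition centralizer (G : groupType) (x : G) : set G :=
  [set y | commute x y].

Definition conj_class (G : groupType) (x : G) : set G :=
  range (fun g => x ^ g).

Definition deficient (G : groupType) (x : G) : Prop :=
  x <> 1 /\ generated [set x] `<` centralizer x.

(* Deficiency is invariant under conjugation, so the choice of the
   representative is immaterial. *)
Definition deficient_class (G : groupType) (C : set G) : Prop :=
  exists2 x, deficient x & C = conj_class x.

Definition D1_group (G : groupType) : Prop :=
  exists! C : set G, deficient_class C.

Definition finitely_generated (G : groupType) (H : set G) : Prop :=
  exists2 A : set G, finite_set A & H = generated A.

Definition locally_finite (G : groupType) : Prop :=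
  forall H : set G, is_subgroup H -> finitely_generated H -> finite_set H.

(* Main.v *)
From HB Require Import structures.
Require Import Defs.
From mathcomp Require Import all_fingroup all_solvable ssralg zify.
From mathcomp Require Import fintype finset.
Set Implicit Arguments.
Unset Strict Implicit.
Unset Printing Implicit Defensive.
Import GroupScope FiniteModule.

(** A deficient element [d] is taken as fixed.  Every non-trivial [x] is either
self-centralizing, that is [C(x) = <x>], or conjugate to [d]; moreover [d^-1]
is deficient too, hence conjugate to [d] ([D1_dichotomy]).  Local finiteness
enters through [finite_model]: finitely many elements always lie in the image of an
embedded finite group, where counting arguments are available.

If [d ^+ 2 <> 1], then [d] is conjugate to its inverse without being equal to
it, so the conjugating element has even order and [G] contains an involution
[t].  It is not conjugate to [d], so it is self-centralizing.  In each finite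
subgroup containing it, [t] inverts an abelian subgroup of index 2
([involution_self_cent_inverts]).  It follows that every element with
non-trivial square has a centralizer of index at most 2 in [G].  One of these
centralizers is finite, and so is [G] ([finite_of_noninvolution_class]).

If [d] is an involution, all elements with non-trivial square are
self-centralizing, so their orders are 4 or odd primes
([order_noninvolution]), and the size of [C(d)] matters.

When [C(d)] is finite of order [k], suppose [G] infinite.  Counting pairs of
conjugates of [d] in the manner of Brauer and Fowler gives, in each finite
subgroup [F], an element [w <> 1] with [|F| <= k + k^2 |C_F(w)|]
([involution_large_cent1]).  For [F] large, [w] has to be self-centralizing of
large prime order [q] with [|F| < q^2], so [<w>] is normal in [F] with abelian
quotient.  The commutator of two elements of [G] chosen in advance thus lies in
a group of prime order exceeding its own order, and [G] is abelian; but then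
[G = C(d)] is finite ([finite_of_involution_finite_cent]).

When [E = C(d)] is infinite, it is elementary abelian, it is the centralizer of
each of its non-trivial elements, and its normalizer [N] permutes these
transitively, so that [N / E] is infinite.  All elements of [N] outside [E]
are self-centralizing of odd prime order, and acting freely on [E] they
form a very small group: if [h] in [N] outside [E] has order [q], then [E]
meets each finite subgroup of [N] containing [h] and [d] in a subgroup of index
[q] ([card_self_cent_outside]).  So [N / E] is finite, a contradiction
([infinite_involution_centralizer_absurd]). *)

(** * A self-centralizing involution in a finite group *)

(** The Sylow 2-subgroup is [<[t]>], since a larger 2-group would normalize,
and hence centralize, it. In the regular representation [t] is then a product
of an odd number of transpositions, so the even elements form a subgroup [K] of
index 2 on which [t] acts without fixed points. So [x |-> x^-1 * x ^ t]
permutes [K], and its values are visibly inverted by [t]. *)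
Lemma involution_self_cent_inverts (gT : finGroupType) (t : gT) :
    #[t] = 2 -> 'C[t] = <[t]> ->
  exists K : {group gT},
    [/\ t \notin K, forall x, (x \in K) || (x * t \in K),
      {in K, forall k, k ^ t = k^-1} & abelian K].
Proof.
move=> ot cGt.
have tt : t * t = 1 by have := expg_order t; rewrite ot.
have sylT : 2.-Sylow([set: gT]) <[t]>.
  have p2t : 2.-group <[t]> by rewrite /pgroup -orderE ot.
  have [P sylP stP] := Sylow_superset (subsetT _) p2t.
  suff <- : P :=: <[t]> by [].
  apply: (nilpotent_sub_norm (pgroup_nil (pHall_pgroup sylP)) stP).
  apply: subset_trans (_ : 'C[t] \subset _); last by rewrite cGt.
  apply: subset_trans (subsetIr _ _) _.
  apply/subsetP => g /normP ngt.
  have : t ^ g \in <[t]> by rewrite -ngt memJ_conjg cycle_id.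
  rewrite cycle2g // => /set2P[/eqP|tg].
    by rewrite conjg_eq1 -order_eq1 ot.
  by apply/cent1P; rewrite /commute (conjgC t g) tg.
have iT : odd #|[set: gT] : <[t]>|.
  by case/and3P: sylT => _ _; rewrite p'natE ?dvdn2 ?negbK.
pose pi (x : gT) := perm (mulIg x).
have piM x y : pi (x * y) = pi x * pi y.
  by apply/permP=> z; rewrite permM !permE mulgA.
have odd_t : odd_perm (pi t).
  rewrite /odd_perm -cardsT -(LagrangeI _ <[t]>) setTI oddM -orderE ot /=.
  rewrite (_ : porbits _ = lcosets <[t]> setT) ?card_lcosets //.
  have e x : porbit (pi t) x = x *: <[t]>.
    have pit i : (pi t ^+ i) x = x * t ^+ i.
      elim: i => [|i IH]; first by rewrite perm1 mulg1.
      by rewrite expgSr permM IH permE expgSr mulgA.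
    apply/setP=> y; apply/porbitP/lcosetP => [[i ->]|[_ /cycleP[i ->] ->]].
      by exists (t ^+ i); rewrite ?mem_cycle ?pit.
    by exists i; rewrite pit.
  apply/setP=> A; apply/imsetP/lcosetsP => [[x _ ->]|[x _ ->]].
    by exists x.
  by exists x.
have Kgrp : group_set [set x | ~~ odd_perm (pi x)].
  apply/group_setP; split=> [|x y].
    rewrite inE (_ : pi 1 = 1) ?odd_perm1 //.
    by apply/permP=> z; rewrite permE perm1 mulg1.
  by rewrite !inE piM odd_permM => /negbTE-> /negbTE->.
pose K := Group Kgrp.
have KE x : (x \in K) = ~~ odd_perm (pi x) by rewrite inE.
have KJ x : x \in K -> x ^ t \in K.
  rewrite !KE conjgE (mulg1_eq tt) !piM !odd_permM odd_t /=.
  by rewrite addbT negbK.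
have invK : {in K, forall k, k ^ t = k^-1}.
  move=> k Kk.
  pose phi x := x^-1 * x ^ t.
  have phiK : phi @: K \subset K.
    by apply/subsetP => _ /imsetP[x Kx ->]; rewrite groupM ?groupV ?KJ.
  have inj : {in K &, injective phi}.
    move=> x y Kx Ky /= e; apply/eqP; rewrite -divg_eq1.
    have : x * y^-1 \in K by rewrite groupM ?groupV.
    have : x * y^-1 \in 'C[t].
      suff fx : (x * y^-1) ^ t = x * y^-1.
        by apply/cent1P; rewrite /commute conjgC fx.
      rewrite conjMg conjVg; apply: (mulgI x^-1).
      by rewrite mulgA -/(phi x) e /phi mulgK mulKg.
    by rewrite cGt cycle2g // !inE => /orP[//|/eqP->]; rewrite odd_t.
  have {phiK}phiK : phi @: K = K.
    by apply/eqP; rewrite eqEcard phiK card_in_imset /=.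
  have /imsetP[x Kx ->] : k \in phi @: K by rewrite phiK.
  by rewrite /phi conjMg conjVg -conjgM tt conjg1 (invMg x^-1) invgK.
exists K; split=> // [|x|]; first by rewrite KE odd_t.
  by rewrite !KE piM odd_permM odd_t addbT negbK orNb.
apply/centsP=> x Kx y Ky; apply: invg_inj.
by rewrite -invK ?groupM // conjMg !invK // -invMg.
Qed.

(** * Counting products of two involutions *)

(** A Brauer-Fowler count. The class [T] of [t] has [n / k] elements, for [n]
the group order and [k = #|'C[t]|]. Each of the [(n / k)^2] products [s * s']
of two involutions in [T] is inverted by [s], so a given [x <> 1] arises at
most [#|'C[x]|] times, while [1] arises [n / k] times. *)
Lemma involution_large_cent1 (gT : finGroupType) (t : gT) :
    #[t] = 2 ->
  exists2 w : gT, w != 1 &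
    #|gT| <= (#|'C[t]| + #|'C[t]| ^ 2 * #|'C[w]|)%N.
Proof.
move=> ot; set k := #|_|.
have nt1 : t != 1 by rewrite -order_gt1 ot.
pose w := [arg max_(x > t | x != 1) #|'C[x]| ]; exists w.
  by rewrite /w; case: arg_maxnP.
have cw (x : gT) : x != 1 -> #|'C[x]| <= #|'C[w]|.
  by move=> ntx; rewrite /w; case: arg_maxnP => // y _ maxy; apply: maxy.
pose T := t ^: [set: gT].
have invT s : s \in T -> s^-1 = s.
  case/imsetP=> g _ ->; rewrite -conjVg; congr (_ ^ _).
  by apply/eqP; rewrite eq_invg_mul -(expg_order t) ot.
have cardT : (#|T| * k)%N = #|gT|.
  by rewrite mulnC -index_cent1 setTI -cardsT (Lagrange (subsetT 'C[t])).
have pairs : (#|T| * #|T| <= #|T| + #|gT| * #|'C[w]|)%N.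
  rewrite -cardsX -sum1_card.
  rewrite (partition_big (fun p => p.1 * p.2) predT) //= (bigD1 1) //=.
  apply: leq_add.
    rewrite sum1_card. 
    rewrite -(card_imset T (_ : injective (fun s => (s, s)))); last by move=> ? ? [].
    apply/subset_leq_card/subsetP=> -[s s'].
    case/andP=> /setXP[Ts Ts'] /eqP /= e.
    by apply/imsetP; exists s => //; rewrite -(mulg1_eq e) invT.
  apply: (@leq_trans (\sum_(x | x != 1) #|'C[w]|)); last first.
    by rewrite sum_nat_const; apply: leq_mul => //; apply: max_card.
  apply: leq_sum => x ntx; apply: leq_trans (cw x ntx).
  rewrite sum1_card.
  have [e|[[s0 s0']]] := set_0Vmem [set p in setX T T | p.1 * p.2 == x].
    rewrite (_ : #|_| = 0) // -(cards0 (gT * gT)%type) -e.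
    by apply: eq_card => p; rewrite [RHS]inE.
  rewrite !inE /= => /andP[/andP[Ts0 Ts0'] /eqP e0].
  have invx s s' : s \in T -> s' \in T -> s * s' = x -> x ^ s = x^-1.
    by move=> Ts Ts' <-; rewrite conjgE -mulgA mulKg invMg !invT.
  rewrite -(card_in_imset (f := fun p : gT * gT => s0^-1 * p.1)).
    apply/subset_leq_card/subsetP=> z /imsetP[[s s']].
    case/andP=> /setXP[Ts Ts'] /eqP /= e ->.
    have fx : x ^ (s0^-1 * s) = x.
      by rewrite conjgM invT // (invx _ _ Ts0 Ts0') // conjVg (invx _ _ Ts Ts') ?invgK.
    by apply/cent1P/commute_sym; rewrite /commute conjgC fx.
  move=> [s s'] [r r'] /andP[_ /eqP /= e] /andP[_ /eqP /= e'] /mulgI sr.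
  by rewrite -sr in e' *; rewrite -e in e'; move/mulgI: e' => ->.
have k0 : 0 < k by apply: cardG_gt0.
have T0 : 0 < #|T| by apply/card_gt0P; exists t; apply: class_refl.
rewrite -cardT -mulnA -{3}(muln1 #|T|) -mulnDr leq_pmul2l // in pairs.
rewrite -cardT; apply: (leq_trans (leq_mul pairs (leqnn k))).
by rewrite mulnDl mul1n mulnAC mulnn.
Qed.

(** * Self-centralizing elements outside an elementary abelian normal 2-subgroup *)

Section SelfCentralizingOutside.

Variables (gT : finGroupType) (M V : {group gT}).
Hypotheses (nsVM : V <| M) (ntV : V :!=: 1).
Hypothesis V2 : {in V, forall v, v ^+ 2 = 1}.
Hypothesis pr_MV : {in M :\: V, forall h, prime #[h]}.
Hypothesis odd_MV : {in M :\: V, forall h, odd #[h]}.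
Hypothesis cent_MV : {in M :\: V, forall h, 'C_M[h] \subset <[h]>}.

Let abV : abelian V.
Proof.
have : 2.-abelem V by apply: exponent2_abelem; apply/exponentP.
by case/and3P.
Qed.

Let nVM : M \subset 'N(V). Proof. exact: normal_norm. Qed.
Let sVM : V \subset M. Proof. exact: normal_sub. Qed.

Let cycle_TI_V h : h \in M :\: V -> <[h]> :&: V = 1.
Proof.
move=> MVh; apply: prime_TIg; first by rewrite -orderE pr_MV.
by rewrite cycle_subG; case/setDP: MVh.
Qed.

(** The sum over an orbit of [<[h]>] is fixed by [h], and the action of [h] on
[V] has only the trivial fixed point. *)
Let sum_cycle_act0 h (u : fmod_of abV) :
  h \in M :\: V -> (\sum_(k in <[h]>) u ^@ k = 0)%R.
Proof.
move=> MVh; have [Mh _] := setDP MVh; set s := (\sum_(k in _) _)%R.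
have nVh : h \in 'N(V) by apply: (subsetP nVM).
have s_fixed : (s ^@ h = s)%R.
  rewrite /s actr_sum [RHS](reindex_inj (mulIg h)) /=.
  apply: eq_big => [k | k hk]; first by rewrite groupMr ?cycle_id.
  by rewrite actrM //; apply: (subsetP _ k hk); rewrite cycle_subG.
have : fmval s \in <[h]> :&: V.
  rewrite inE fmodP andbT (subsetP (cent_MV MVh)) // inE (subsetP sVM) ?fmodP //.
  by apply/cent1P; rewrite /commute conjgC -fmvalJ ?s_fixed.
by rewrite cycle_TI_V // => /set1P s1; apply: val_inj.
Qed.

(** This is the argument that a Frobenius group of order [q * r] cannot act
freely on an abelian group. If [g] normalizes [Q = <[h]>] without belonging to
it, take any [u != 0] in [V] (written additively) and consider the conjugates
of [R = <[g]>] under [Q]: the orbit sum of [u] over each of them vanishes.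
Added up, these sums count [u] itself [#|Q|] times and, for each [y != 1] in
[R], the orbit sum over the coset [y Q], which vanishes too. So [#|Q|] kills
[u], which is impossible as [#|Q|] is odd and [u] has order 2. *)
Lemma self_cent_self_norm h : h \in M :\: V -> 'N_M(<[h]>) = <[h]>.
Proof.
move=> MVh; have [Mh nVh] := setDP MVh.
set Q := <[h]>; have sQM : Q \subset M by rewrite cycle_subG.
apply/eqP; rewrite eqEsubset subsetI sQM normG !andbT.
apply/subsetP=> g /setIP[Mg nQg]; apply: contraT => nQg'.
have nVg : g \notin V.
  apply: contra nQg' => Vg; apply: (subsetP (cent_MV MVh)).
  rewrite inE Mg; apply/cent1P/commute_sym/commgP.
  suff : [~ h, g] \in <[h]> :&: V by rewrite cycle_TI_V // => /set1P ->.
  rewrite inE commgEl groupM ?groupV ?memJ_norm ?cycle_id //=.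
  rewrite -commgEl commgEr groupM // memJ_norm ?groupV //.
  exact: (subsetP nVM).
have MVg : g \in M :\: V by apply/setDP.
set R := <[g]>.
have sRM : R \subset M by rewrite cycle_subG.
have tiRQ : R :&: Q = 1.
  by apply: prime_TIg; rewrite -?orderE ?pr_MV // cycle_subG.
have [v Vv ntv] := trivgPn _ ntV.
pose u := fmod abV v.
have sumR i : i \in Q -> (\sum_(y in R) u ^@ (y ^ i) = 0)%R.
  move=> Qi; have nVi : i \in 'N(V) by rewrite (subsetP nVM) ?(subsetP sQM).
  rewrite (eq_bigr (fun y => (u ^@ i^-1) ^@ y ^@ i)%R).
    by rewrite -actr_sum sum_cycle_act0 ?act0r.
  move=> y Ry; have nVy : y \in 'N(V) by rewrite (subsetP nVM) ?(subsetP sRM).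
  by rewrite conjgE !actrM ?groupM ?groupV.
(* The map [i |-> [~ y, i]] permutes [Q], so [y ^ i] ranges over [y Q]. *)
have sumQ y : y \in R -> y != 1 -> (\sum_(i in Q) u ^@ (y ^ i) = 0)%R.
  move=> Ry nty.
  have nQy : y \in 'N(Q).
    by apply: (subsetP _ y Ry); rewrite cycle_subG.
  have f_inj : {in Q &, injective (fun i => [~ y, i])}.
    move=> i j Qi Qj /= /mulgI e.
    apply/eqP; rewrite -divg_eq1.
    suff : i * j^-1 \in R :&: Q by rewrite tiRQ => /set1P ->.
    rewrite inE (groupM Qi) ?groupV // andbT.
    have MVy : y \in M :\: V.
      rewrite inE (subsetP sRM) // andbT; apply: contra nty => Vy.
      have : y \in R :&: V by rewrite inE Ry.
      by rewrite cycle_TI_V // => /set1P ->.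
    have sYR : <[y]> \subset R by rewrite cycle_subG.
    apply: (subsetP sYR); apply: (subsetP (cent_MV MVy)).
    rewrite inE (subsetP sQM) ?(groupM Qi) ?groupV //=.
    by apply/cent1P/commute_sym; rewrite /commute conjgC conjgM e conjgK.
  have fQ : [set [~ y, i] | i in Q] = Q.
    apply/eqP; rewrite eqEcard card_in_imset // leqnn andbT.
    apply/subsetP=> _ /imsetP[i Qi ->].
    by rewrite commgEr groupM // memJ_norm ?groupV.
  have := sum_cycle_act0 (actr u y) MVh.
  rewrite -/Q -{1}fQ big_imset //= => sum0; rewrite -[RHS]sum0.
  apply: eq_bigr => i Qi.
  have Qyi : [~ y, i] \in Q.
    by rewrite commgEr groupM // memJ_norm ?groupV.
  rewrite -actrM; first by rewrite commgEl mulKVg.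
    by rewrite (subsetP nVM) ?(subsetP sRM).
  by rewrite (subsetP nVM) ?(subsetP sQM).
have : (\sum_(i in Q) \sum_(y in R) u ^@ (y ^ i) = 0)%R by apply: big1.
rewrite exchange_big /= (bigD1 1) //= [X in (_ + X)%R]big1; last first.
  by move=> y /andP[Ry nty]; apply: sumQ.
rewrite GRing.addr0 (eq_bigr (fun _ => u)); last first.
  by move=> i _; rewrite conj1g actr1.
rewrite GRing.sumr_const => /(congr1 val) /=.
rewrite fmvalZ fmodK // -orderE -(odd_double_half #[h]) odd_MV //.
by rewrite expgS -muln2 mulnC expgM V2 // expg1n mulg1 => v1; rewrite v1 eqxx in ntv.
Qed.


Let kappa h := class_support <[h]>^# M.

(** By self-normalization, the [#|M| / #[h]] conjugates of [<[h]>] in [M] are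
distinct, and they meet trivially as they have prime order. *)
Let card_kappa h : h \in M :\: V -> (#|kappa h| * #[h] = #[h].-1 * #|M|)%N.
Proof.
move=> MVh; have [Mh nVh] := setDP MVh.
have sQM : <[h]> \subset M by rewrite cycle_subG.
have ti : normedTI <[h]>^# M <[h]>.
  apply/normedTI_memJ_P; split=> // [|a g].
    by rewrite setD_eq0 subG1 cycle_eq1 -order_gt1 prime_gt1 // pr_MV.
  rewrite !inE => /andP[nta Qa] Mg; rewrite conjg_eq1 nta /=.
  apply/idP/idP=> [Qag|Qg]; last by rewrite groupJ.
  have gen b : b \in <[h]> -> b != 1 -> <[b]> = <[h]>.
    move=> Qb ntb; apply/eqP; rewrite eqEsubset cycle_subG Qb /=.
    apply: contraR ntb => nhb.
    have := @prime_TIg _ <[h]> <[b]>; rewrite -orderE pr_MV // => /(_ isT nhb).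
    rewrite (setIidPr _) ?cycle_subG // => /eqP; by rewrite cycle_eq1.
  rewrite -(self_cent_self_norm MVh) inE Mg; apply/normP.
  by rewrite -{1}(gen a) // -cycleJ gen ?conjg_eq1.
rewrite (card_support_normedTI ti) -mulnA (mulnC #|M : _|) Lagrange //.
by rewrite orderE [in RHS](cardsD1 1) group1.
Qed.

Let kappa_sub h : h \in M :\: V -> kappa h \subset M :\: V.
Proof.
move=> MVh; have [Mh nVh] := setDP MVh.
apply/subsetP=> z /imset2P[a g]; rewrite !inE => /andP[nta ha] Mg ->.
have Ma : a \in M by apply: (subsetP _ a ha); rewrite cycle_subG.
apply/andP; split; last by rewrite groupJ.
rewrite memJ_norm ?(subsetP nVM) //; apply: contra nta => Va.
have : a \in <[h]> :&: V by rewrite inE ha.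
by rewrite cycle_TI_V // => /set1P ->.
Qed.

Let kappa_disjoint h k : h \in M :\: V -> k \in M :\: V ->
  k \notin kappa h -> [disjoint kappa h & kappa k].
Proof.
move=> MVh MVk; apply: contraR => /pred0Pn[z /andP[/=]].
case/imset2P=> a g; rewrite !inE => /andP[nta ha] Mg ->.
case/imset2P=> b f; rewrite !inE => /andP[ntb kb] Mf e.
have {e}e : a ^ (g * f^-1) = b by rewrite conjgM e conjgK.
have : k \in <[b]>.
  rewrite -cycle_subG; apply: contraR ntb => nkb.
  have := @prime_TIg _ <[k]> <[b]>; rewrite -orderE pr_MV // => /(_ isT nkb).
  by rewrite (setIidPr _) ?cycle_subG // => /eqP; rewrite cycle_eq1.
rewrite -e cycleJ => /imsetP[c ac kc].
rewrite kc; apply: imset2_f; last by rewrite groupM ?groupV.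
rewrite !inE; apply/andP; split; last first.
  by apply: (subsetP _ c ac); rewrite cycle_subG.
have [_] := setDP MVk; apply: contra => /eqP c1.
by rewrite kc c1 conj1g group1.
Qed.

(** The sets [kappa h] are pairwise equal or disjoint and each covers at least
two thirds of [M], so only one of them can fit inside [M :\: V]. *)
Lemma card_self_cent_outside h :
  h \in M :\: V -> #|M| = (#|V| * #[h])%N.
Proof.
move=> MVh.
have order_ge3 k : k \in M :\: V -> 3 <= #[k].
  move=> MVk; have := prime_gt1 (pr_MV MVk); have := odd_MV MVk.
  by case: #[k] => [|[|[|]]].
have kappa_ge k : k \in M :\: V -> (2 * #|M| <= 3 * #|kappa k|)%N.
  by move=> MVk; have := card_kappa MVk; have := order_ge3 k MVk; nia.
have all_kappa : kappa h = M :\: V.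
  apply/eqP; rewrite eqEsubset kappa_sub //=; apply/subsetP=> k MVk.
  apply: contraT => nhk; have := kappa_disjoint MVh MVk nhk.
  rewrite -leq_card_setU => /eqP dis.
  have : #|kappa h :|: kappa k| <= #|M|.
    apply: subset_leq_card; rewrite subUset.
    by rewrite !(subset_trans (kappa_sub _) (subsetDl _ _)).
  have := cardG_gt0 M; have := kappa_ge h MVh; have := kappa_ge k MVk.
  by rewrite dis; lia.
have := card_kappa MVh; rewrite all_kappa.
have := cardsID V M; rewrite (setIidPr sVM).
case: #[h] (order_ge3 h MVh) => //= q _ <-.
by rewrite !mulnS mulnDr (mulnC q #|M :\: V|) => /addIn->; rewrite mulnC.
Qed.

End SelfCentralizingOutside.

(** * Self-centralizing subgroups of prime order and small index *)

(** Two different conjugates of [<[w]>] would have a product of [#[w] ^ 2]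
elements, more than there are, so [<[w]>] is normal. Commutators act trivially
on it because automorphisms of a cyclic group commute, so they lie in [<[w]>],
its own centralizer. *)
Lemma self_cent_small_index_comm (gT : finGroupType) (w : gT) :
    prime #[w] -> 'C[w] = <[w]> -> #|gT| < #[w] ^ 2 ->
  forall x y : gT, [~ x, y] \in <[w]>.
Proof.
move=> pr_w cw small.
have nw g : w ^ g \in <[w]>.
  apply: contraLR small => nwg; rewrite -leqNgt.
  have ti : <[w ^ g]> :&: <[w]> = 1.
    by apply: prime_TIg; rewrite -?orderE ?orderJ // cycle_subG.
  have := mul_cardG <[w ^ g]> <[w]>; rewrite ti cards1 muln1 -!orderE orderJ.
  by rewrite -mulnn => ->; apply: max_card.
suff comm x y : [~ x^-1, y^-1] \in <[w]> by move=> x y; rewrite -(invgK x) -(invgK y).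
rewrite -cw; suff fx : w ^ [~ x^-1, y^-1] = w.
  by apply/cent1P/commute_sym; rewrite /commute conjgC fx.
apply: (conjg_inj (y * x)); rewrite /= -conjgM -commgCV !conjgM.
have /cycleP[i ex] := nw x; have /cycleP[j ey] := nw y.
by rewrite ex ey !conjXg ex ey -!expgM mulnC.
Qed.

(** * Finite subgroups of a locally finite group as finite group types *)

(** The enumeration [r] of a finite subgroup yields a type with finite and
group structures; the closure proof is a parameter so that these structures can
be attached to the type. *)
Definition subgroup_seq (G : groupType) (r : seq G)
  (grp_r : group_closed [in r]) : Type := seq_sub r.

Section SubgroupSeq.

Variables (G : groupType) (r : seq G) (grp_r : group_closed [in r]).

Local Notation rT := (subgroup_seq grp_r).

HB.instance Definition _ := SubChoice.on rT.
HB.instance Definition _ := Finite.on rT.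
HB.instance Definition _ := SubChoice_isSubGroup.Build G [in r] rT grp_r.

End SubgroupSeq.

Lemma sub_generated (G : groupType) (A : set G) x : A x -> Defs.generated A x.
Proof. by move=> Ax B [_]; apply. Qed.

Lemma generated_min (G : groupType) (A B : set G) :
  is_subgroup B -> (A `<=` B)%classic -> (Defs.generated A `<=` B)%classic.
Proof. by move=> grpB sAB x; apply. Qed.

Lemma is_subgroup_generated (G : groupType) (A : set G) :
  is_subgroup (Defs.generated A).
Proof.
split=> [B [[]] //|x y Ax Ay B [grpB sAB]].
by apply: grpB.2; [apply: Ax | apply: Ay].
Qed.

(** Passing to an abstract finite group, rather than working with finite
subsets of [G], gives access to the theory of finite groups. *)
Lemma finite_model (G : groupType) (hlf : locally_finite G) (s : seq G) :
  exists (gT : finGroupType) (f : UMagmaMorphism.type gT G),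
    injective f /\ forall x, x \in s -> exists u, x = f u.
Proof.
pose H := Defs.generated [set` s]%classic.
have grpH : is_subgroup H by exact: is_subgroup_generated.
have /finite_seqP[r Hr] : finite_set H.
  by apply: hlf => //; exists [set` s]%classic => //; apply: finite_seq.
have rH x : (x \in r) <-> H x by rewrite Hr.
have grp_r : group_closed [in r].
  case: grpH => H1 HV; split; first by apply/rH.
  by move=> x y /rH Hx /rH Hy; apply/rH; apply: HV.
exists (subgroup_seq grp_r : finGroupType), (val : subgroup_seq grp_r -> G).
split; first exact: val_inj.
move=> x sx; have rx : x \in r by apply/rH; apply: sub_generated.
by exists (SeqSub rx).
Qed.

(** * Self-centralizing and deficient elements *)

(** In a torsion group, natural exponents reach the whole cyclic subgroup, so
this says that the centralizer of [x] is generated by [x]. *)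
Definition self_cent (G : groupType) (x : G) : Prop :=
  forall y, commute x y -> exists n, y = x ^+ n.

Section LocallyFinite.

Variables (G : groupType) (hlf : locally_finite G).
Implicit Types (x y g : G).

Lemma locally_finite_torsion x : exists2 n, 0 < n & x ^+ n = 1.
Proof.
have [gT [f [f_inj fs]]] := finite_model hlf [:: x].
have [u ->] := fs x (mem_head _ _).
by exists #[u]; rewrite ?order_gt0 // -gmulfXn expg_order gmulf1.
Qed.

Lemma self_cent_finite x : self_cent x -> finite_set [set y | commute x y]%classic.
Proof.
move=> scx; have [n n_gt0 xn] := locally_finite_torsion x.
apply: (@sub_finite_set _ _ [set` [seq x ^+ i | i <- iota 0 n]]%classic).
  move=> y /= /scx[m ->]; apply/mapP; exists (m %% n).
    by rewrite mem_iota /= ltn_mod.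
  by rewrite {1}(divn_eq m n) expgD mulnC expgM xn expg1n mul1g.
exact: finite_seq.
Qed.

Lemma is_subgroupV (A : set G) x : is_subgroup A -> A x -> A x^-1.
Proof. by move=> [A1 AV] Ax; rewrite -div1g; apply: AV. Qed.

Lemma is_subgroup_centralizer x : is_subgroup (centralizer x).
Proof.
split=> [|y z xy xz]; first exact: commute1.
by apply: commuteM => //; apply: commuteV.
Qed.

Lemma generated_sub_centralizer x :
  (Defs.generated [set x] `<=` centralizer x)%classic.
Proof.
have sx : ([set x] `<=` centralizer x)%classic by move=> _ ->.
exact: (generated_min (is_subgroup_centralizer x) sx).
Qed.

(** By torsion, the powers of [x] with natural exponents already form a
subgroup. *)
Lemma not_deficient_self_cent x : x <> 1 -> ~ deficient x -> self_cent x.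
Proof.
move=> x1 ndx y xy; have [n n_gt0 xn] := locally_finite_torsion x.
have grp_pow : is_subgroup [set z | exists n, z = x ^+ n]%classic.
  split=> [|_ _ [i ->] [j ->]]; first by exists 0.
  exists (i + n.-1 * j); rewrite expgD; congr (_ * _); apply: mulg1_eq.
  by rewrite -expgD -mulSn prednK // expgM xn expg1n.
apply: (generated_min grp_pow (A := [set x]%classic)) => [_ ->|].
  by exists 1%N.
apply: contrapT => nxy; apply: ndx; split=> //; split.
  exact: generated_sub_centralizer.
by move=> /(_ y xy).
Qed.

Lemma deficientV x : deficient x -> deficient x^-1.
Proof.
move=> [x1 [_ ns]]; split.
  by move=> xV; apply: x1; rewrite -(invgK x) xV invg1.
split; first exact: generated_sub_centralizer.
move=> s; apply: ns => y xy.
have grpx := is_subgroup_generated [set x]%classic.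
apply: (generated_min grpx (A := [set x^-1]%classic)) => [_ ->|].
  by apply: (is_subgroupV grpx); apply: sub_generated.
apply: s; apply: commute_sym; apply: commuteV; exact: commute_sym.
Qed.

Lemma D1_dichotomy : D1_group G ->
  exists d : G, [/\ d <> 1, exists g, d^-1 = d ^ g
    & forall x, x <> 1 -> self_cent x \/ exists g, x = d ^ g].
Proof.
move=> [C [[d dd ->] uniqC]]; exists d.
have conj_d x : deficient x -> exists g, x = d ^ g.
  move=> dx; have : conj_class x x by exists 1; rewrite ?conjg1.
  rewrite -(uniqC (conj_class x)); last by exists x.
  by case=> g _ <-; exists g.
split; [by case: dd | exact/conj_d/deficientV |].
move=> x x1; have [dx|ndx] := pselect (deficient x); first by right; apply: conj_d.
by left; apply: not_deficient_self_cent.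
Qed.

End LocallyFinite.

(** * The deficient elements are not involutions *)

Section Models.

Variables (G : groupType) (gT : finGroupType) (f : UMagmaMorphism.type gT G).
Hypothesis f_inj : injective f.

Lemma self_cent_cent1 u : self_cent (f u) -> 'C[u] = <[u]>.
Proof.
move=> scu; apply/eqP; rewrite eqEsubset cycle_subG cent1id andbT.
apply/subsetP=> v /cent1P uv.
have [|n] := scu (f v); first exact/gmulf_commute/commute_sym.
by rewrite -gmulfXn => /f_inj->; apply: mem_cycle.
Qed.

Lemma model_eq1 u : (f u = 1) <-> (u = 1).
Proof.
split=> [fu|->]; last exact: gmulf1.
by apply: f_inj; rewrite fu gmulf1.
Qed.

Lemma model_commute u v : commute (f u) (f v) -> commute u v.
Proof. by rewrite /commute -!gmulfM => /f_inj. Qed.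

End Models.

Lemma order_involution (gT : finGroupType) (t : gT) : t != 1 -> t ^+ 2 = 1 -> #[t] = 2.
Proof.
move=> t1 tt; apply: nt_prime_order => //.
Qed.

Section SelfCentInvolution.

Variables (G : groupType) (hlf : locally_finite G) (t : G).
Hypotheses (t1 : t <> 1) (tt : t ^+ 2 = 1) (sct : self_cent t).

(** In a finite subgroup containing [t], [x] and [g], let [K] be the abelian
subgroup of index 2 inverted by [t]. Elements outside [K] are involutions, so
[x] lies in [K]; so does one of [g] and [g * t]. *)
Lemma self_cent_involution_dihedral (x g : G) : x ^+ 2 <> 1 ->
  x ^ t = x^-1 /\ (commute x g \/ commute x (g * t)).
Proof.
move=> xx.
have [gT [f [f_inj fs]]] := finite_model hlf [:: t; x; g].
have [T eT] : exists u, t = f u by apply: fs; rewrite !inE eqxx.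
have [X eX] : exists u, x = f u by apply: fs; rewrite !inE eqxx ?orbT.
have [U eU] : exists u, g = f u by apply: fs; rewrite !inE eqxx ?orbT.
have TT : T ^+ 2 = 1 by apply/(model_eq1 f_inj); rewrite gmulfXn -eT.
have oT : #[T] = 2.
  by apply: order_involution => //; apply/eqP => /(model_eq1 f_inj); rewrite -eT.
have [|K [_ orK invK abK]] := involution_self_cent_inverts oT.
  by apply: (self_cent_cent1 f_inj); rewrite -eT.
have XK : X \in K.
  have /orP[//|KXT] := orK X; case: xx.
  rewrite eX -gmulfXn; apply/(model_eq1 f_inj).
  have := invK _ KXT.
  have TV : T^-1 = T by apply: mulg1_eq.
  rewrite conjgE invMg TV -!mulgA => /mulgI.
  by rewrite [T * T]TT mulg1 => e; rewrite expg2 {1}e mulVg.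
have comm u v : u \in K -> v \in K -> commute (f u) (f v).
  move=> Ku Kv; apply: gmulf_commute.
  by apply: (centsP abK).
split; first by rewrite eX eT -gmulfJ invK ?gmulfV.
rewrite eX eU eT -gmulfM.
by have /orP[K1|K1] := orK U; [left|right]; apply: comm.
Qed.

Lemma self_cent_involution_finite (x : G) :
  x ^+ 2 <> 1 -> finite_set [set y | commute x y]%classic -> finite_set [set: G]%classic.
Proof.
move=> xx finC.
apply: (@sub_finite_set _ _
  ([set y | commute x y] `|` (fun y : G => y * t^-1) @` [set y | commute x y])%classic).
  move=> g _; have [_ [xg|xg]] := self_cent_involution_dihedral g xx.
    by left.
  by right; exists (g * t) => //; rewrite mulgK.
by rewrite finite_setU; split=> //; apply: finite_image.
Qed.

End SelfCentInvolution.

Section NoninvolutionClass.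

Variables (G : groupType) (hlf : locally_finite G) (d : G).
Hypothesis dV : exists g, d^-1 = d ^ g.
Hypothesis dich : forall x, x <> 1 -> self_cent x \/ exists g, x = d ^ g.

(** An element inverting [d] has even order: otherwise it would be a power of
its square, which centralizes [d]. *)
Lemma real_element_involution : d ^+ 2 <> 1 ->
  exists t : G, t <> 1 /\ t ^+ 2 = 1.
Proof.
move=> dd; case: dV => g eg.
have [gT [f [f_inj fs]]] := finite_model hlf [:: d; g].
have [D eD] : exists u, d = f u by apply: fs; rewrite !inE eqxx.
have [U eU] : exists u, g = f u by apply: fs; rewrite !inE eqxx ?orbT.
have DU : D ^ U = D^-1 by apply: f_inj; rewrite gmulfV gmulfJ -eD -eU.
have evU : ~~ odd #[U].
  apply/negP=> odU; apply: dd; rewrite eD -gmulfXn; apply/(model_eq1 f_inj).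
  have DUU : D ^ (U ^+ 2) = D by rewrite conjgM DU conjVg DU invgK.
  have : U \in 'C[D].
    have -> : U = (U ^+ 2) ^+ (#[U].+1)./2.
      by rewrite -expgM mulnC muln2 even_halfK ?expgS ?expg_order ?mulg1 //= odU.
    apply: groupX; apply/cent1P/commute_sym; rewrite /commute conjgC DUU //.
  move/cent1P/commute_sym => cDU.
  by move: DU; rewrite conjgE cDU mulKg => e; rewrite expg2 {1}e mulVg.
have o2 : #[U] = (#[U]./2 * 2)%N by rewrite muln2 even_halfK.
exists (f (U ^+ #[U]./2)); split.
  move/(model_eq1 f_inj)/eqP; rewrite -order_dvdn => /dvdn_leq.
  have := order_gt0 U; lia.
by rewrite -gmulfXn -expgM -o2 expg_order gmulf1.
Qed.

(** It suffices to find a finite centralizer among those of the elements with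
non-trivial square. The involution [t] at hand confines the class of [d] to [d]
and [d^-1], so any other such element is self-centralizing and will do. If
there is no other one, then [d] itself will do: multiplying an involution of
[C(d)] by [d] gives an element with non-trivial square, so there are very few
of them. *)
Lemma finite_of_noninvolution_class : d ^+ 2 <> 1 -> finite_set [set: G]%classic.
Proof.
move=> dd; have [t [t1 tt]] := real_element_involution dd.
have sct : self_cent t.
  have [//|[g tg]] := dich t1; case: dd; apply: (conjg_inj g).
  by rewrite conjXg -tg tt conj1g.
have dih := self_cent_involution_dihedral hlf t1 tt sct.
have fin := self_cent_involution_finite hlf t1 tt sct.
have tV : t^-1 = t by apply: mulg1_eq.
have dcl g : d ^ g = d \/ d ^ g = d^-1.
  have [dt [c|c]] := dih d g dd; [left|right].
    by rewrite conjgE c mulKg.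
  have : d ^ (g * t) = d by rewrite conjgE c mulKg.
  by rewrite conjgM => /(canRL (conjgK t)) ->; rewrite tV dt.
have [[y [yy nyd nyd']]|noy] :=
    pselect (exists y, [/\ y ^+ 2 <> 1, y <> d & y <> d^-1]).
  apply: (fin y yy); apply: (self_cent_finite hlf).
  have [|//|[g yg]] := dich (x := y); first by move=> y1; rewrite y1 expg1n in yy.
  by case: (dcl g); rewrite -yg.
apply: (fin d dd).
apply: (@sub_finite_set _ _ [set` [:: 1; d; d^-1; d^-1 ^+ 2]]%classic).
  move=> c /= dc; rewrite !inE.
  have sq y : y ^+ 2 <> 1 -> y = d \/ y = d^-1.
    move=> yy; have [|nyd] := eqVneq y d; first by left.
    right; apply: contrapT => nyd'; apply: noy; exists y; split=> //; exact/eqP.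
  have [cc|cc] := eqVneq (c ^+ 2) 1; last first.
    by case: (sq c) => [|->|->]; first exact/eqP; rewrite eqxx ?orbT.
  have : (d * c) ^+ 2 <> 1 by rewrite expgMn // cc mulg1.
  case/sq => [e|e].
    have -> : c = 1 by apply: (mulgI d); rewrite mulg1.
    by rewrite eqxx.
  have -> : c = d^-1 ^+ 2 by rewrite expg2 -{2}e mulKg.
  by rewrite eqxx !orbT.
exact: finite_seq.
Qed.

End NoninvolutionClass.

(** * The deficient elements are involutions with finite centralizer *)

Lemma infinite_uniq_seq (T : eqType) (A : set T) n : ~ finite_set A ->
  exists s : seq T, [/\ uniq s, size s = n & forall x, x \in s -> A x].
Proof.
move=> infA; elim: n => [|n [s [us ss sA]]]; first by exists [::].
have [x [Ax sx]] : exists x, A x /\ x \notin s.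
  apply: contrapT => nx; apply: infA.
  apply: (@sub_finite_set _ _ [set` s]%classic); last exact: finite_seq.
  by move=> x Ax /=; apply: contraT => sx; case: nx; exists x.
exists (x :: s); split=> /=; rewrite ?sx ?us ?ss // => y.
by rewrite inE => /orP[/eqP->|/sA].
Qed.

(** For [p] the least prime divisor of the order of [u], the power [u ^+ p] is
trivial or an involution: it cannot be self-centralizing, as [u] lies in its
centralizer but not in the smaller group that it generates. *)
Lemma order_noninvolution (gT : finGroupType) (u : gT) :
    (forall v : gT, v ^+ 2 != 1 -> 'C[v] = <[v]>) -> u ^+ 2 != 1 ->
  #[u] = 4 \/ prime #[u] /\ odd #[u].
Proof.
move=> sc uu; have o_gt2 : 2 < #[u].
  rewrite ltnNge; apply: contra uu => le2; apply/eqP.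
  have := expg_order u; have := order_gt0 u.
  by case: #[u] le2 => [|[|[|]]] //= _ _; rewrite ?expg1 => -> //; apply: expg1n.
have m_gt1 : 1 < #[u] by apply: ltnW.
have p_pr := pdiv_prime m_gt1; have p_dvd := pdiv_dvd #[u].
set p := pdiv _ in p_pr p_dvd *.
have p_gt1 := prime_gt1 p_pr.
have [o_p|neq] := eqVneq #[u] p.
  rewrite o_p in o_gt2 *; right; split=> //.
  by have [p2|//] := even_prime p_pr; rewrite p2 in o_gt2.
have [r er] := dvdnP p_dvd.
have ov : #[u ^+ p] = r by rewrite orderXdiv // er mulnK ?prime_gt0.
have r_gt1 : 1 < r.
  move: neq (order_gt0 u); rewrite er; case: r {er ov} => [|[|r]] //.
  by rewrite mul1n eqxx.
have v1 : u ^+ p != 1 by rewrite -order_gt1 ov.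
have vv : (u ^+ p) ^+ 2 = 1.
  apply/eqP; apply: contraT => /sc Cv.
  have : <[u]> \subset 'C[u ^+ p].
    by rewrite cycle_subG; apply/cent1P; apply: commuteX.
  rewrite Cv => /subset_leq_card; rewrite -!orderE ov er leqNgt.
  by rewrite ltn_Pmulr // ltnW.
have r2 : r = 2 by rewrite -ov; apply: order_involution.
have : p <= 2 by apply: pdiv_min_dvd => //; rewrite er r2 dvdn_mulr.
by left; rewrite er r2 (_ : p = 2) //; apply/eqP; rewrite eqn_leq p_gt1 andbT.
Qed.

Section InvolutionClass.

Variables (G : groupType) (hlf : locally_finite G) (d : G).
Hypotheses (d1 : d <> 1) (dd : d ^+ 2 = 1).
Hypothesis dich : forall x, x <> 1 -> self_cent x \/ exists g, x = d ^ g.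

Lemma noninvolution_self_cent (x : G) : x ^+ 2 <> 1 -> self_cent x.
Proof.
move=> xx; have [|//|[g xg]] := dich (x := x).
  by move=> x1; rewrite x1 expg1n in xx.
by case: xx; rewrite xg -conjXg dd conj1g.
Qed.

Lemma noninvolution_cent1 (gT : finGroupType) (f : UMagmaMorphism.type gT G) (v : gT) :
  injective f -> v ^+ 2 != 1 -> 'C[v] = <[v]>.
Proof.
move=> f_inj vv; apply: (self_cent_cent1 f_inj); apply: noninvolution_self_cent.
by rewrite -gmulfXn => /(model_eq1 f_inj)/eqP; apply/negP.
Qed.

(** The lower bound [c] for [#|'C[w]|] is chosen to exceed what is possible for
an involution ([k] or 2), the order 4, the exponent [m] that kills the
commutator under study, and to make [k + k ^ 2 * q < q ^ 2] for [q > c]. *)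
Lemma finite_of_involution_finite_cent :
  finite_set [set y | commute d y]%classic -> finite_set [set: G]%classic.
Proof.
move=> finC; have /finite_seqP[r Er] := finC.
have memr y : commute d y -> y \in r.
  by move=> dy; have : [set y | commute d y]%classic y by []; rewrite Er.
apply: contrapT => infG.
have comm (x y : G) : commute x y.
  have [m m_gt0 xym] := locally_finite_torsion hlf [~ x, y].
  pose k := size r; pose c := (k ^ 2 + k + m + 4)%N.
  have [s [us ss _]] := infinite_uniq_seq (k + k ^ 2 * c).+1 infG.
  have [gT [f [f_inj fs]]] := finite_model hlf [:: d, x, y & s].
  have [D eD] : exists u, d = f u by apply: fs; rewrite !inE eqxx.
  have [X eX] : exists u, x = f u by apply: fs; rewrite !inE eqxx ?orbT.
  have [Y eY] : exists u, y = f u by apply: fs; rewrite !inE eqxx ?orbT.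
  have big : k + k ^ 2 * c < #|gT|.
    rewrite -ss -(size_codom f); apply: uniq_leq_size => // z sz.
    have [|u ->] := fs z; first by rewrite !inE sz !orbT.
    exact: codom_f.
  have card_conj u g : f u = d ^ g -> #|'C[u]| <= k.
    move=> fu; rewrite cardE -(size_map (fun v => f v ^ g^-1)).
    apply: uniq_leq_size.
      by rewrite map_inj_uniq ?enum_uniq // => v w /conjg_inj/f_inj.
    move=> z /mapP[v]; rewrite mem_enum => /cent1P uv ->.
    apply: memr; have /(gmulf_commute f) := uv.
    rewrite fu => c1.
    have : commute ((d ^ g) ^ g^-1) (f v ^ g^-1).
      by rewrite /commute -!conjMg c1.
    by rewrite conjgK.
  have oD : #[D] = 2.
    apply: order_involution; first by apply/eqP => /(model_eq1 f_inj); rewrite -eD.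
    by apply/(model_eq1 f_inj); rewrite gmulfXn -eD.
  have [w w1 bound] := involution_large_cent1 oD.
  have kD : #|'C[D]| <= k by apply: (card_conj _ 1); rewrite conjg1.
  have {}bound : #|gT| <= (k + k ^ 2 * #|'C[w]|)%N.
    apply: leq_trans bound _; apply: leq_add => //.
    by rewrite leq_mul2r leq_sqr kD orbT.
  have cw : c < #|'C[w]|.
    have := leq_trans big bound; rewrite ltn_add2l ltn_mul2l => /andP[]//.
  have ww : w ^+ 2 != 1.
    apply: contraTneq cw => ww; rewrite -leqNgt.
    have [|scw|[g wg]] := dich (x := f w).
    - by move/(model_eq1 f_inj)/eqP; apply/negP.
    - rewrite (self_cent_cent1 f_inj scw) -orderE (order_involution w1 ww) /c; lia.
    - by apply: leq_trans (card_conj _ _ wg) _; rewrite /c; lia.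
  have Cw := noninvolution_cent1 f_inj ww; rewrite Cw -orderE in bound cw.
  have [o4|[pr_w _]] := order_noninvolution (fun v => @noninvolution_cent1 _ f v f_inj) ww.
    by move: cw; rewrite o4 /c; lia.
  have small : #|gT| < #[w] ^ 2 by move: cw bound; rewrite /c; nia.
  have XYw := self_cent_small_index_comm pr_w Cw small X Y.
  have XYm : [~ X, Y] ^+ m = 1.
    by apply/(model_eq1 f_inj); rewrite gmulfXn gmulfR -eX -eY.
  have : #[[~ X, Y]] %| #[w] by apply: order_dvdG.
  move/(proj2 (elimT primeP pr_w)) => /orP[]; last first.
    move=> /eqP oXY; have : #[w] %| m by rewrite -oXY order_dvdn XYm.
    by move/(dvdn_leq m_gt0); move: cw; rewrite /c; lia.
  rewrite order_eq1 => /commgP XY; rewrite eX eY; exact: gmulf_commute.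
apply: infG; apply: sub_finite_set finC => y _; exact: comm.
Qed.

End InvolutionClass.

(** * The deficient elements are involutions with infinite centralizer *)

(** A commutator is a product of squares; so squares that are trivial, or
central of order 2, control commutativity. *)
Lemma commg_squares (G : groupType) (a b : G) :
  [~ a, b] = (a ^+ 2)^-1 * (a * b^-1) ^+ 2 * b ^+ 2.
Proof.
rewrite !expg2 invMg commgEl conjgE -!mulgA; congr (_ * _).
by rewrite !mulKg.
Qed.

Section InfiniteInvolutionCentralizer.

Variables (G : groupType) (hlf : locally_finite G) (d : G).
Hypotheses (d1 : d <> 1) (dd : d ^+ 2 = 1).
Hypothesis dich : forall x, x <> 1 -> self_cent x \/ exists g, x = d ^ g.
Hypothesis infC : ~ finite_set [set y | commute d y]%classic.

Let sc := noninvolution_self_cent dd dich.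

(** If [v ^+ 2 <> 1], then [d] is a power of [v] by self-centralization. When
[v] has order 4, this leaves only [d = v ^+ 2]. Otherwise [v ^+ 2] is also
self-centralizing, so [v] has odd order, and so has its power [d], which is
absurd. *)
Lemma cent_involution_squares (v : G) : commute d v -> v ^+ 2 = 1 \/ v ^+ 2 = d.
Proof.
move=> dv; have [|/eqP vv] := eqVneq (v ^+ 2) 1; [by left | right].
have [n dn] := sc vv (commute_sym dv).
have [v4|/eqP v4] := eqVneq ((v ^+ 2) ^+ 2) 1.
  have : d = v ^+ (n %% 4).
    rewrite dn {1}(divn_eq n 4) expgD mulnC expgM.
    by rewrite (_ : v ^+ 4 = 1) ?expg1n ?mul1g // -v4 -expgM.
  have : n %% 4 < 4 by rewrite ltn_mod.
  case: (n %% 4) => [|[|[|[|]]]] // _ e.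
    by case: vv; rewrite -(expg1 v) -e.
  by case: vv; rewrite -dd e -expgM (_ : (3 * 2 = 2 * 2 + 2)%N) // expgD expgM v4 mul1g.
have [m vm] := sc v4 (commute_sym (commuteX 2 (commute_refl v))).
case: d1; rewrite -[LHS](_ : d ^+ (2 * m) = d); first by rewrite expgM dd expg1n.
by rewrite dn -expgM mulnC 2!expgM -vm.
Qed.

(** For [u] in [C(d)] with [u ^+ 2 <> 1], the commutators [[~ u, v]] with [v]
in [C(d)] are [1] or [d]. So the elements of [C(d)] lie in at most two cosets
of the finite group [C(u)]. *)
Lemma cent_involution_exponent2 (u : G) : commute d u -> u ^+ 2 = 1.
Proof.
move=> du; apply: contrapT => uu; apply: infC.
have finCu := self_cent_finite hlf (sc uu).
have dV : d^-1 = d by apply: mulg1_eq.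
have comm v : commute d v -> [~ u, v] = 1 \/ [~ u, v] = d.
  move=> dv; rewrite commg_squares.
  have duv : commute d (u * v^-1) by apply: commuteM => //; apply: commuteV.
  have dd' : d * d = 1 by [].
  by case: (cent_involution_squares du) => ->;
     case: (cent_involution_squares dv) => ->;
     case: (cent_involution_squares duv) => ->;
     rewrite ?invg1 ?dV ?mul1g ?mulg1 ?dd' ?mul1g ?mulg1; auto.
have [[v0 [dv0 uv0]]|nov] := pselect (exists v, commute d v /\ [~ u, v] = d).
  apply: (@sub_finite_set _ _
    ([set y | commute u y] `|` (fun y : G => y * v0) @` [set y | commute u y])%classic).
    move=> v /= dv; case: (comm v dv) => uv; first by left; apply/commgP/eqP.
    right; exists (v * v0^-1); last by rewrite mulgVK.
    have uvv : u ^ v = u ^ v0.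
      by apply: (mulgI u^-1); rewrite -!commgEl uv uv0.
    by rewrite /= /commute [LHS]conjgC conjgM uvv conjgK.
  by rewrite finite_setU; split=> //; apply: finite_image.
apply: sub_finite_set finCu => v /= dv; apply/commgP/eqP.
by case: (comm v dv) => // uv; case: nov; exists v.
Qed.

Lemma cent_involution_comm (a b : G) : commute d a -> commute d b -> commute a b.
Proof.
move=> da db; apply/commgP/eqP; rewrite commg_squares.
rewrite !cent_involution_exponent2 ?invg1 ?mulg1 //.
by apply: commuteM => //; apply: commuteV.
Qed.

Lemma cent_involution_conj (e : G) : commute d e -> e <> 1 -> exists g, e = d ^ g.
Proof.
move=> de e1; have [sce|//] := dich e1; case: infC.
apply: sub_finite_set (self_cent_finite hlf sce) => y /= dy.
exact: cent_involution_comm.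
Qed.

(** A non-trivial [e] in [C(d)] is conjugate to [d], so [C(e)] is abelian like
[C(d)]; it contains [d], so it is contained in [C(d)]. *)
Lemma cent_involution_TI (e x : G) :
  commute d e -> e <> 1 -> commute e x -> commute d x.
Proof.
move=> de e1; have [g eg] := cent_involution_conj de e1.
have back y : commute e y -> commute d (y ^ g^-1).
  move=> ey; have : commute (e ^ g^-1) (y ^ g^-1).
    by rewrite /commute -!conjMg ey.
  by rewrite eg conjgK.
move=> ex; have := cent_involution_comm (back _ (commute_sym de)) (back _ ex).
by rewrite /commute -!conjMg => /conjg_inj.
Qed.

Lemma cent_involution_norm (e h : G) :
  commute d (d ^ h) -> commute d e -> commute d (e ^ h).
Proof.
move=> dh de; apply: (@cent_involution_TI (d ^ h)) => //.
  by move/eqP; rewrite conjg_eq1 => /eqP.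
by rewrite /commute -!conjMg de.
Qed.

(** If [h ^+ 2 = 1] then [d * d ^ h] is fixed by [h]. It lies in [C(d)], so it
is trivial or has its centralizer in [C(d)]; in both cases [h] centralizes [d].
*)
Lemma norm_noninvolution (h : G) :
  commute d (d ^ h) -> ~ commute d h -> h ^+ 2 <> 1.
Proof.
move=> dh ndh hh; apply: ndh.
have dV : d^-1 = d by apply: mulg1_eq.
have [e1|/eqP e1] := eqVneq (d * d ^ h) 1.
  by rewrite /commute conjgC -(mulg1_eq e1) dV.
apply: (@cent_involution_TI (d * d ^ h)) => //; first exact: commuteM.
by rewrite /commute [LHS]conjgC conjMg -conjgM [h * h]hh conjg1 dh.
Qed.

(** The normalizer of [C(d)] is the set of [h] such that [d ^ h] is in [C(d)],
and its orbit of [d] is all of [C(d)] minus 1. Fix [h0] in the normalizer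
outside [C(d)], with [h0 ^+ q = 1], and take a finite subgroup containing [h0]
and enough elements to move [d] to [q.+1] places. There, the orbit of [d] under
the normalizer has as many elements as the order of [h0]. *)
Lemma infinite_involution_centralizer_absurd : False.
Proof.
have infE : ~ finite_set [set y | commute d y /\ y <> 1]%classic.
  move=> finE; apply: infC.
  apply: (@sub_finite_set _ _ ([set y | commute d y /\ y <> 1] `|` [set 1])%classic).
    by move=> y dy; have [->|/eqP y1] := eqVneq y 1; [right | left].
  by rewrite finite_setU; split=> //; apply: finite_set1.
have [h0 [dh0 ndh0]] : exists h, commute d (d ^ h) /\ ~ commute d h.
  have [e [de e1 ed]] : exists e, [/\ commute d e, e <> 1 & e <> d].
    have [ab [us ss sE]] := infinite_uniq_seq 2 infE.
    case: ab us ss sE => [|a [|b [|? ?]]] // us _ sE.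
    have [da a1] := sE a (mem_head _ _).
    have [|db b1] := sE b; first by rewrite !inE eqxx orbT.
    have [ad|/eqP ad] := eqVneq a d; last by exists a.
    by exists b; split=> // bd; rewrite ad bd /= !inE eqxx in us.
  have [g eg] := cent_involution_conj de e1.
  exists g; rewrite -eg; split=> // dg.
  by case: ed; rewrite eg conjgE dg mulKg.
have [q q_gt0 hq] := locally_finite_torsion hlf h0.
have [s [us ss sE]] := infinite_uniq_seq q.+1 infE.
have [l el] : exists l : seq G, [seq d ^ g | g <- l] = s.
  elim: s sE {us ss} => [|e r IH] er; first by exists [::].
  have [|l el] := IH; first by move=> x xr; apply: er; rewrite inE xr orbT.
  have [de e1] := er e (mem_head _ _); have [g eg] := cent_involution_conj de e1.
  by exists (g :: l); rewrite /= el -eg.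
have [gT [f [f_inj fs]]] := finite_model hlf [:: d, h0 & l].
have [D eD] : exists u, d = f u by apply: fs; rewrite !inE eqxx.
have [H eH] : exists u, h0 = f u by apply: fs; rewrite !inE eqxx ?orbT.
have inV u : (u \in 'C[D]) <-> commute d (f u).
  rewrite eD; split=> [/cent1P uD|/(model_commute f_inj) Du].
    exact/gmulf_commute/commute_sym.
  exact/cent1P/commute_sym.
have inM u : (D ^ u \in 'C[D]) <-> commute d (d ^ f u).
  by rewrite inV gmulfJ -eD.
pose Mset := [set u : gT | D ^ u \in 'C[D]].
have MsetE u : (u \in Mset) = (D ^ u \in 'C[D]) by apply: in_set.
have grpM : group_set Mset.
  apply/group_setP; split=> [|u v]; rewrite !MsetE ?conjg1 ?cent1id //.
  move=> /inM Mu /inM Mv; apply/inM; rewrite gmulfM conjgM.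
  exact: cent_involution_norm.
pose M := Group grpM; pose V := 'C[D]%G.
have ME u : (u \in M) = (D ^ u \in 'C[D]) := MsetE u.
have sVM : V \subset M.
  by apply/subsetP=> u /inV Vu; rewrite ME; apply/inM; rewrite conjgE Vu mulKg.
have nsVM : V <| M.
  apply/andP; split=> //; apply/subsetP=> u; rewrite ME => /inM Mu.
  rewrite inE; apply/subsetP=> _ /imsetP[v /inV Vv ->]; apply/inV.
  by rewrite gmulfJ; apply: cent_involution_norm.
have D1 : D != 1 by apply/eqP => /(model_eq1 f_inj); rewrite -eD.
have ntV : V :!=: 1 by apply/trivgPn; exists D; rewrite ?cent1id.
have V2 : {in V, forall v, v ^+ 2 = 1}.
  move=> v /inV Vv; apply/(model_eq1 f_inj); rewrite gmulfXn.
  exact: cent_involution_exponent2.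
have nonV u : u \in M :\: V -> u ^+ 2 != 1.
  case/setDP; rewrite ME => /inM Mu /negP Vu.
  apply/eqP=> /(model_eq1 f_inj); rewrite gmulfXn.
  by apply: norm_noninvolution => // /inV.
have scM (v : gT) : v ^+ 2 != 1 -> 'C[v] = <[v]>.
  exact: (noninvolution_cent1 dd dich f_inj).
have pr_odd u : u \in M :\: V -> prime #[u] /\ odd #[u].
  move=> MVu; have [o4|//] := order_noninvolution scM (nonV _ MVu).
  have [Mu nVu] := setDP MVu; case/negP: nVu; apply/inV.
  have Vuu : u ^+ 2 \in V.
    apply: contraT => nVuu; have : u ^+ 2 \in M :\: V.
      by rewrite inE nVuu groupX.
    by move/nonV; rewrite -expgM -[(2 * 2)%N]o4 expg_order eqxx.
  apply: (@cent_involution_TI (f (u ^+ 2))); first exact/inV.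
    by move/(model_eq1 f_inj)/eqP; apply/negP/nonV.
  exact/gmulf_commute/commute_sym/commuteX.
have MVH : H \in M :\: V.
  apply/setDP; split; first by rewrite ME; apply/inM; rewrite -eH.
  by apply/negP=> /inV; rewrite -eH.
have cardM : #|M| = (#|V| * #[H])%N.
  apply: card_self_cent_outside MVH => //.
  - by move=> u /pr_odd[].
  - by move=> u /pr_odd[].
  by move=> u /nonV/scM <-; apply: subsetIr.
have oH : #[H] <= q.
  apply: dvdn_leq => //; rewrite order_dvdn; apply/eqP/(model_eq1 f_inj).
  by rewrite gmulfXn -eH.
have : #|D ^: M| = #[H].
  apply/eqP; rewrite -index_cent1 (setIidPr sVM).
  by rewrite -(eqn_pmul2l (cardG_gt0 V)) Lagrange // cardM.
suff : q.+1 <= #|D ^: M| by move=> /[swap] ->; rewrite ltnNge oH.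
rewrite -ss cardE -(size_map f); apply: uniq_leq_size => // e es.
move: (es); rewrite -el => /mapP[g lg eg].
have [|u gu] := fs g; first by rewrite !inE lg !orbT.
apply/mapP; exists (D ^ u); last by rewrite eg gu gmulfJ -eD.
rewrite mem_enum; apply: imset_f; rewrite ME; apply/inM.
by rewrite -gu -eg; case: (sE e es).
Qed.

End InfiniteInvolutionCentralizer.

Local Open Scope classical_set_scope.

Theorem theorem7 (G : groupType) (hlf : locally_finite G) (hD1 : D1_group G) :
  finite_set [set: G].
Proof.
have [d [d1 dV dich]] := D1_dichotomy hlf hD1.
have [dd|/eqP dd] := eqVneq (d ^+ 2)%g 1%g; last first.
  exact: finite_of_noninvolution_class dd.
have [finC|infC] := pselect (finite_set [set y | commute d y]).
  exact: finite_of_involution_finite_cent finC.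
by have := infinite_involution_centralizer_absurd hlf d1 dd dich infC.
Qed.
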